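(* Let $w=w(x_1,\dots,x_t)$ be a group-word and let $G$ be a profinite group. If the set of values $\{w(g_1,\dots,g_t) : g_1,\dots,g_t\in G\}$ has cardinality less than $2^{\aleph_0}$, then the verbal subgroup $w(w(G))$ is finite.
   Context: A group-word $w=w(x_1,\dots,x_t)$ is a nontrivial element of the free group on $x_1,\dots,x_t$, regarded as a function $G^t\to G$ on any group $G$; its values are the elements $w(g_1,\dots,g_t)$. For a profinite group $H$, $w(H)$ denotes the closed subgroup of $H$ topologically generated by all $w$-values in $H$. Thus $w(w(G))$ is the closed subgroup of $K=w(G)$ topologically generated by the $w$-values in $K$. *)

(* Defs.v *)
From HB Require Import structures.
From mathcomp Require Import all_boot all_order.
From mathcomp Require Import all_classical.
From mathcomp Require Import topology.
Set Implicit Arguments. Unset Strict Implicit. Unset Printing Implicit Defensive.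
Local Open Scope classical_set_scope.

(* A group-word in the letters x_1..x_t is an element of the free group on
   'I_t, represented (uniquely) as a freely reduced sequence of letters
   (i, b): x_i if b = false, x_i^-1 if b = true. *)
Definition letter (t : nat) := ('I_t * bool)%type.

Definition cancelling {t} (a b : letter t) : bool := (a.1 == b.1) && (a.2 != b.2).

Definition freely_reduced {t} (w : seq (letter t)) : bool :=
  ~~ has (fun p => cancelling p.1 p.2) (zip w (behead w)).

Definition group_word {t} (w : seq (letter t)) : Prop :=
  freely_reduced w /\ w <> [::].

Definition word_eval {G : Type} (mul : G -> G -> G) (inv : G -> G) (one : G)
  {t} (w : seq (letter t)) (g : 'I_t -> G) : G :=
  foldr (fun a acc => mul (if a.2 then inv (g a.1) else g a.1) acc) one w.

Definition profinite_group {G : topologicalType} (mul : G -> G -> G)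
  (inv : G -> G) (one : G) : Prop :=
  [/\ (forall x y z, mul x (mul y z) = mul (mul x y) z),
      (forall x, mul one x = x /\ mul x one = x),
      (forall x, mul (inv x) x = one /\ mul x (inv x) = one),
      continuous (fun p : G * G => mul p.1 p.2) /\ continuous inv &
      [/\ compact [set: G], hausdorff_space G & totally_disconnected [set: G]]].

Definition is_subgroup {G : Type} (mul : G -> G -> G) (inv : G -> G) (one : G)
  (H : set G) : Prop :=
  [/\ H one, (forall x y, H x -> H y -> H (mul x y)) & (forall x, H x -> H (inv x))].

Definition closed_gen {G : topologicalType} (mul : G -> G -> G) (inv : G -> G)
  (one : G) (S : set G) : set G :=
  [set x | forall H : set G, is_subgroup mul inv one H -> closed H -> S `<=` H -> H x].

Definition word_values_in {G : Type} (mul : G -> G -> G) (inv : G -> G) (one : G)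
  {t} (w : seq (letter t)) (K : set G) : set G :=
  [set word_eval mul inv one w g | g in [set g : 'I_t -> G | forall i, K (g i)]].

Definition verbal {G : topologicalType} (mul : G -> G -> G) (inv : G -> G)
  (one : G) {t} (w : seq (letter t)) (K : set G) : set G :=
  closed_gen mul inv one (word_values_in mul inv one w K).

(* Main.v *)
Require Import Defs.
From HB Require Import structures.
From mathcomp Require Import all_boot all_order.
From mathcomp Require Import all_classical.
From mathcomp Require Import topology.

(* Write X for the set of w-values in G and K = w(G). Two facts carry the proof:
   a continuous image of a compact Hausdorff space that does not contain
   continuum many points is attained constantly on some nonempty open set
   (a Cantor scheme), and an element whose conjugacy class has fewer than
   continuum many elements therefore has an open centralizer. In particular the
   elements of X have open centralizers, so the elements of K with open
   centralizer form a dense subgroup A of K.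

   Applied to w on K^t, the first fact gives a in A^t and a neighbourhood of 1 in
   K^t on which w(ac) = w(a); for c close to 1 the entries of c commute with
   those of a, so w(ac) = w(a)w(c) and w(c) = 1. By compactness K^t is covered by
   finitely many translates sW with s in A^t and w = 1 on W. As the entries of s
   have finitely many conjugates, w(sc)w(c)^-1 takes finitely many values, so w
   takes finitely many values on K. Each of them is torsion, by a
   transfer into a central subgroup of finite index (Schur), and Dietzmann's
   lemma shows that finitely many torsion elements permuted by conjugation
   generate a finite subgroup. *)

Set Implicit Arguments. Unset Strict Implicit. Unset Printing Implicit Defensive.
Local Open Scope classical_set_scope.

Local Notation invg := (@monoid.inv _).

Lemma finite_pigeonhole (T : Type) (S : set T) (f : nat -> T) :
  finite_set S -> (forall n, S (f n)) -> exists m k, f m = f (m + k.+1).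
Proof.
move=> finS Sf; apply: contrapT => noeq.
have f_inj : injective f.
  move=> m n eqf; apply/eqP; case: ltngtP => // ltmn; exfalso; apply: noeq.
    by exists m, (n - m).-1; rewrite prednK ?subn_gt0// subnKC// ltnW.
  by exists n, (m - n).-1; rewrite prednK ?subn_gt0// subnKC// ltnW.
apply: infinite_nat; rewrite (_ : setT = f @^-1` S); last first.
  by apply/seteqP; split=> // n _; exact: Sf.
by apply: finite_preimage => // m n _ _; exact: f_inj.
Qed.

(** * Words and elements with finite conjugacy class in abstract groups *)

Section GroupWords.
Local Open Scope group_scope.
Variable G : groupType.
Implicit Types (x y : G) (K : set G).

Definition subgroup K := is_subgroup *%g invg 1 K.

Definition torsion x := exists n, x ^+ n.+1 = 1.

Lemma finite_powers_torsion x (S : set G) :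
  finite_set S -> (forall n, S (x ^+ n)) -> torsion x.
Proof.
move=> /finite_pigeonhole/[apply]-[m [k]]; rewrite expgnDr => e; exists k.
by apply: (mulgI (x ^+ m)); rewrite mulg1.
Qed.

Section Words.
Context {t : nat}.
Implicit Types (w : seq (letter t)) (g : 'I_t -> G).

Definition weval w g := word_eval *%g invg 1 w g.

Lemma weval_cons a w g :
  weval (a :: w) g = (if a.2 then (g a.1)^-1 else g a.1) * weval w g.
Proof. by []. Qed.

Lemma weval_in K w g : subgroup K -> (forall i, K (g i)) -> K (weval w g).
Proof.
move=> [K1 KM KV] Kg; elim: w => [//|[i b] w IHw].
by rewrite weval_cons; apply: KM => //=; case: b => //; exact: KV.
Qed.

(** Multiplicativity is required only on [K], since the transfer used later is a homomorphism only
    on a subgroup. *)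
Lemma weval_hom K (phi : G -> G) w g : subgroup K ->
  (forall x y, K x -> K y -> phi (x * y) = phi x * phi y) ->
  (forall i, K (g i)) -> phi (weval w g) = weval w (phi \o g).
Proof.
move=> sK phiM Kg; have [K1 KM KV] := sK.
have phi1 : phi 1 = 1.
  by apply: (mulgI (phi 1)); rewrite -phiM// !mulg1.
have phiV x : K x -> phi x^-1 = (phi x)^-1.
  by move=> Kx; apply/esym/mulg1_eq; rewrite -phiM ?mulgV//; exact: KV.
elim: w => [//|[i b] w IHw]; rewrite !weval_cons phiM ?IHw//=.
- by case: b => //; rewrite phiV.
- by case: b => //; exact: KV.
- exact: weval_in.
Qed.

Lemma subgroupT : subgroup setT. Proof. by []. Qed.

Lemma weval_conj w g x : weval w (fun i => g i ^ x) = weval w g ^ x.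
Proof.
by apply/esym/(weval_hom (phi := conjg^~ x) w subgroupT) => // y z _ _; exact: conjMg.
Qed.

Lemma subgroup_cent x : subgroup [set y | commute x y].
Proof.
split=> /=; [exact: commute1|exact: commuteM|exact: commuteV].
Qed.

Lemma weval_mul_commute w g h : (forall i j, commute (g i) (h j)) ->
  weval w (fun i => g i * h i) = weval w g * weval w h.
Proof.
move=> cgh; elim: w => [|[i b] w IHw]; first by rewrite /weval/= mulg1.
rewrite !weval_cons IHw /=.
set u := weval w g; set v := weval w h.
have cu j : commute (h j) u.
  by apply: (weval_in w (subgroup_cent (h j))) => k /=; exact/commute_sym.
case: b; last by rewrite -!mulgA; congr (_ * _); rewrite !mulgA cu.
rewrite cgh invgM -!mulgA; congr (_ * _); rewrite !mulgA; congr (_ * _).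
by apply/commute_sym/commuteV/commute_sym.
Qed.

Lemma weval_expg w g n : (forall i j, commute (g i) (g j)) ->
  weval w (fun i => g i ^+ n) = weval w g ^+ n.
Proof.
move=> cgg; elim: n => [|n IHn].
  by apply: (weval_in (K := [set 1])) => //; split=> [|_ _ -> ->|_ ->] /=;
    rewrite ?mulg1 ?invg1.
rewrite expgS -IHn -weval_mul_commute; last by move=> i j; exact: commuteX.
by congr weval; apply/funext => i; rewrite expgS.
Qed.

End Words.

Definition fc x := finite_set (range (conjg x)).

Lemma fcM x y : fc x -> fc y -> fc (x * y).
Proof.
move=> fx fy; apply: sub_finite_set (finite_image2 *%g fx fy).
by move=> _ [g _ <-]; exists (x ^ g); [exists g|exists (y ^ g);
  [exists g|rewrite conjMg]].
Qed.

Lemma fcV x : fc x -> fc x^-1.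
Proof.
move=> fx; apply: sub_finite_set (finite_image invg fx).
by move=> _ [g _ <-]; exists (x ^ g); [exists g|rewrite conjVg].
Qed.

Lemma fcJ x y : fc x -> fc (x ^ y).
Proof.
apply: sub_finite_set => _ [g _ <-]; exists (y * g) => //.
by rewrite conjgM.
Qed.

(* The factors of [w(sc)] coming from [s] can be moved to the left of those
   coming from [c], at the price of conjugating them. *)
Lemma fc_weval_ratio t (w : seq (letter t)) (s : 'I_t -> G) :
  (forall i, fc (s i)) -> exists E : set G, [/\ finite_set E, E `<=` fc &
    forall c, E (weval w (fun i => s i * c i) / weval w c)].
Proof.
move=> fcs; elim: w => [|[i b] w [E [finE fcE Ew]]].
  exists [set 1]; split=> [||c]; first exact: finite_set1.
    move=> _ ->; apply: sub_finite_set (finite_set1 1) => _ [g _ <-].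
    by rewrite /= conj1g.
  by rewrite /weval/= mulgV.
have fcs' : fc (if b then (s i)^-1 else s i) by case: b => //; exact: fcV.
pose F1 := \bigcup_(x in E) range (conjg x).
pose F2 := range (conjg (if b then (s i)^-1 else s i)).
have finF1 : finite_set F1 by apply: bigcup_finite => // x /fcE.
exists [set x * y | x in F2 & y in F1]; split=> [||c].
- exact: finite_image2.
- move=> _ [_ [g _ <-] [_ [x Ex [h _ <-]] <-]].
  by apply: fcM; apply: fcJ => //; exact: fcE.
- rewrite !weval_cons /=.
  pose ci := if b then (c i)^-1 else c i.
  (* With [r] the ratio for the tail, the new ratio is [s i * r ^ (c i)^-1] for a positive letter
     and [(s i)^-1 ^ c i * r ^ c i] for an inverse one. *)
  exists ((if b then (s i)^-1 else s i) ^ (if b then c i else 1)).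
    by exists (if b then c i else 1).
  exists ((weval w (fun i => s i * c i) / weval w c) ^ ci^-1).
    by exists (weval w (fun i => s i * c i) / weval w c) => //; exists ci^-1.
  rewrite /ci !conjgE; case: {F2 fcs'} b ci => ci.
    by rewrite !invgM !invgK !mulgA mulgK.
  by rewrite invg1 !mul1g !mulg1 invgM invgK !mulgA.
Qed.

End GroupWords.

(** * Transfer into a central subgroup of finite index *)

Section Transfer.
Local Open Scope group_scope.
Variables (G : groupType) (B Z : set G) (T : choiceType) (f : G -> T).
Hypotheses (sB : subgroup B) (sZ : subgroup Z) (sZB : Z `<=` B).
Hypothesis cZB : forall z b, Z z -> B b -> commute z b.
Hypothesis fE : forall b c, B b -> B c -> f b = f c <-> Z (b / c).
Hypothesis finf : finite_set (f @` B).

(* [f] labels the right cosets of the central subgroup [Z] in [B]; [phi] is the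
   transfer homomorphism. *)
Lemma transfer : exists n (phi : G -> G),
  [/\ forall x, B x -> Z (phi x),
      forall x y, B x -> B y -> phi (x * y) = phi x * phi y &
      forall z, Z z -> phi z = z ^+ n.+1].
Proof.
have [B1 BM BV] := sB; have [Z1 ZM ZV] := sZ.
have [s us sE] : exists2 s : seq T, uniq s & f @` B = [set` s].
  have /finite_seqP[s ->] := finf; exists (undup s); first exact: undup_uniq.
  by apply/seteqP; split=> o /=; rewrite mem_undup.
have sP o : o \in s -> (f @` B) o by rewrite sE.
have fs b : B b -> f b \in s.
  move=> Bb; suff : (f @` B) (f b) by rewrite sE.
  by exists b.
pose r o := xget 1 [set b | B b /\ f b = o].
have rP o : o \in s -> B (r o) /\ f (r o) = o.
  by move=> /sP[b Bb fb]; rewrite /r; case: xgetP => [x _ //|/(_ b)[]].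
pose act b o := f (r o * b).
have act_s b o : B b -> o \in s -> act b o \in s.
  by move=> Bb /rP[Br _]; apply/fs/BM.
have Zcoc b o : B b -> o \in s -> Z (r o * b / r (act b o)).
  move=> Bb os; have [Br _] := rP _ os.
  have [Br' fr'] := rP _ (act_s _ _ Bb os).
  by apply/fE; rewrite ?fr'//; exact: BM.
have actM b c o : B b -> B c -> o \in s -> act (b * c) o = act c (act b o).
  move=> Bb Bc os; have [Br _] := rP _ os.
  have [Br' _] := rP _ (act_s _ _ Bb os).
  have Bbc := BM _ _ Bb Bc.
  apply/fE; [exact: BM Br Bbc|exact: BM Br' Bc|].
  by rewrite [r o * _]mulgA mulgKA; exact: Zcoc.
have act1 o : o \in s -> act 1 o = o by move=> /rP[_ fr]; rewrite /act mulg1.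
have act_perm b : B b -> perm_eq s (map (act b) s).
  move=> Bb; have actK o : o \in s -> act b^-1 (act b o) = o.
    by move=> os; rewrite -actM ?mulgV ?act1//; exact: BV.
  have actKV o : o \in s -> act b (act b^-1 o) = o.
    by move=> os; rewrite -actM ?mulVg ?act1//; exact: BV.
  apply: uniq_perm => //.
    by rewrite map_inj_in_uniq// => o o' os os' e; rewrite -(actK o)// e actK.
  move=> o; apply/idP/mapP => [os|[o' os' ->]]; last exact: act_s.
  by exists (act b^-1 o); [apply: act_s => //; exact: BV|rewrite actKV].
(* [Z] is made into a commutative monoid, so that the transfer becomes a big product that can be
   split and reindexed by the permutation [act x] of the cosets. *)
pose Zt := {x : G | `[< Z x >]}.
have valZ (u : Zt) : Z (val u) by case: u => x /= /asboolW.
pose e : Zt := exist _ 1 (asboolT Z1).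
pose op (u v : Zt) : Zt :=
  exist _ (val u * val v) (asboolT (ZM _ _ (valZ u) (valZ v))).
have opA : associative op by move=> u v x; apply: val_inj; exact: mulgA.
have opC : commutative op.
  move=> u v; apply: val_inj; apply: cZB; first exact: valZ.
  exact/sZB/valZ.
have op1 : left_id e op by move=> u; apply: val_inj; exact: mul1g.
pose law : Monoid.com_law e := HB.pack op (Monoid.isComLaw.Build Zt e op opA opC op1).
pose zeta b o : Zt := insubd e (r o * b / r (act b o)).
have zetaE b o : B b -> o \in s -> val (zeta b o) = r o * b / r (act b o).
  by move=> Bb os; rewrite insubdK//; apply/asboolT/Zcoc.
pose phi b := val (\big[law/e]_(o <- s) zeta b o).
(* The exponent [n.+1] is the index [size s], which is positive because [s] contains [f 1]. *)
exists (size s).-1, phi; split.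
- by move=> x _; exact: valZ.
- move=> x y Bx By; rewrite /phi.
  rewrite [in X in _ = _ * X](perm_big _ (act_perm _ Bx)) big_map.
  rewrite -[RHS]/(val (law _ _)) -big_split; congr val; apply: eq_big_seq => o os.
  apply: val_inj; rewrite [RHS]/= !zetaE//; [|exact: act_s|exact: BM].
  by rewrite -actM// !mulgA mulgVK.
- move=> z Zz; have Bz := sZB Zz; rewrite prednK; last first.
    by rewrite -has_predT; apply/hasP; exists (f 1) => //; exact: fs.
  (* A central [z] fixes every coset, so each of the [size s] factors of the transfer is [z]
     itself. *)
  have zetaz o : o \in s -> val (zeta z o) = z.
    move=> os; have [Br fr] := rP _ os; rewrite zetaE//.
    have <- : o = act z o.
      rewrite -{1}fr; apply/(fE Br (BM _ _ Br Bz)).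
      by rewrite invgM mulgA -(cZB (ZV _ Zz) Br) mulgK; exact: ZV.
    by rewrite -(cZB Zz Br) mulgK.
  rewrite /phi; elim: s zetaz {us sE sP fs rP act_s Zcoc actM act1 act_perm zetaE phi}
    => [|o s' IHs] zetaz.
    by rewrite big_nil.
  rewrite big_cons /= expgS zetaz ?mem_head// IHs// => o' o's.
  by rewrite zetaz// in_cons o's orbT.
Qed.

End Transfer.

(** * Torsion of word values *)

Section WordTorsion.
Local Open Scope group_scope.
Variables (G : groupType) (t : nat) (w : seq (letter t)).

(** For commuting entries the powers of a value are again values, taken at the powers of the
    entries, so they range over a finite set. *)
Lemma weval_torsion_commute (K : set G) (z : 'I_t -> G) : subgroup K ->
  finite_set (word_values_in *%g invg 1 w K) -> (forall i, K (z i)) ->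
  (forall i j, commute (z i) (z j)) -> torsion (weval w z).
Proof.
move=> [K1 KM KV] finw Kz czz; apply: (finite_powers_torsion finw) => n.
rewrite -weval_expg//; eexists; last by [].
by move=> i /=; elim: n => // n IHn; rewrite expgS; exact: KM.
Qed.

(* With [C] the centralizer of the [a i] and [B] the centralizer of [C] in [K],
   the transfer of [B] to its central subgroup [B `&` C] maps the [w]-value at
   [a] to one with commuting entries. *)
Lemma weval_torsion (K : set G) (a : 'I_t -> G) : subgroup K ->
  finite_set (word_values_in *%g invg 1 w K) ->
  (forall i, K (a i)) -> (forall i, fc (a i)) -> torsion (weval w a).
Proof.
move=> sK finw Ka fca; have [K1 KM KV] := sK.
pose C := [set c | forall i, commute (a i) c].
have sC : subgroup C.
  split=> [i|x y Cx Cy i|x Cx i]; [exact: commute1|exact: commuteM|exact: commuteV].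
pose B := [set b | K b /\ forall c, C c -> commute c b].
have sB : subgroup B.
  split=> [|x y [Kx Bx] [Ky By]|x [Kx Bx]].
  - by split=> // c _; exact: commute1.
  - by split=> [|c Cc]; [exact: KM|apply: commuteM; [exact: Bx|exact: By]].
  - by split=> [|c Cc]; [exact: KV|apply: commuteV; exact: Bx].
have [B1 BM BV] := sB; have [C1 CM CV] := sC.
have Ba i : B (a i) by split=> // c Cc; exact/commute_sym/Cc.
pose Z := B `&` C.
have sZ : subgroup Z.
  split=> [//|x y [Bx Cx] [By Cy]|x [Bx Cx]].
  - by split; [exact: BM|exact: CM].
  - by split; [exact: BV|exact: CV].
have cZB z b : Z z -> B b -> commute z b by move=> [_ Cz] [_]; exact.
(* Two elements of [B] conjugate all the [a i] alike exactly when they lie in the same coset of [Z];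
   finiteness of the classes of the [a i] thus bounds the index. *)
pose f b := [seq a i ^ b | i <- enum 'I_t].
have fE b c : B b -> B c -> f b = f c <-> Z (b / c).
  move=> Bb Bc; have Bbc : B (b / c) by exact/BM/BV.
  have conjE i : a i ^ b = a i ^ c <-> commute (a i) (b / c).
    rewrite (rwP (@commgP _ _ _)) -(rwP (@conjg_fixP _ _ _)) conjgM; split=> [->|e].
      by rewrite conjgK.
    by rewrite -[a i in RHS]e conjgKV.
  split=> [/eq_in_map e|[_ Cbc]].
    by split=> // i; apply/conjE/e; rewrite mem_enum.
  by apply: eq_map => i; apply/conjE.
have finf : finite_set (f @` B).
  rewrite /f; elim: (enum _) => [|i s IHs] /=.
    by apply: sub_finite_set (finite_set1 [::]) => _ [b _ <-].
  apply: sub_finite_set (finite_image2 cons (fca i) IHs) => _ [b Bb <-].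
  by exists (a i ^ b); [exists b|exists [seq a j ^ b | j <- s] => //; exists b].
have [n [phi [phiZ phiM phiX]]] := transfer sB sZ (@subIsetl _ _ _) cZB fE finf.
set v := weval w a; have Bv : B v by exact: weval_in.
have [m phivm] : torsion (phi v).
  rewrite (weval_hom w sB phiM Ba).
  apply: (weval_torsion_commute sK finw) => [i|i j] /=.
    by have [[]] := phiZ _ (Ba i).
  by apply: cZB; [exact: phiZ (Ba i)|have [] := phiZ _ (Ba j)].
have BX k : B (v ^+ k).
  by elim: k => [//|k IHk]; rewrite expgS; exact: BM.
have phiE k : phi (v ^+ k.+1) = phi v ^+ k.+1.
  by elim: k => [//|k IHk]; rewrite expgS phiM// IHk -expgS.
(* Two powers of [v] share a coset, so a positive power of [v] lies in [Z], where [phi] is the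
   [n.+1]-st power map. As [phi v] is torsion, so is [v]. *)
have [i [k fik]] : exists i k, f (v ^+ i) = f (v ^+ (i + k.+1)).
  by apply: (finite_pigeonhole (f := fun i => f (v ^+ i)) finf) => i; exists (v ^+ i).
have Zvk : Z (v ^+ k.+1).
  by have /(fE _ _ (BX _) (BX _)) := esym fik; rewrite addnC expgnDr mulgK.
exists (k.+1 * n.+1 * m.+1).-1; rewrite prednK ?muln_gt0//.
by rewrite expgnA [v ^+ _]expgnA -phiX// phiE expgnAC phivm expg1n.
Qed.

End WordTorsion.

(** * Dietzmann's lemma *)

Section Dietzmann.
Local Open Scope group_scope.
Variables (G : groupType) (S : set G).
Hypotheses (finS : finite_set S) (torS : forall x, S x -> torsion x).
Hypothesis conjS : forall x y, S x -> S y -> S (x ^ y).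

Let mulseq (l : seq G) := foldr *%g 1 l.

Let mulseq_cons x l : mulseq (x :: l) = x * mulseq l. Proof. by []. Qed.

Let mulseq_cat l1 l2 : mulseq (l1 ++ l2) = mulseq l1 * mulseq l2.
Proof. by elim: l1 => [|x l1 IHl]; rewrite ?mul1g//= IHl mulgA. Qed.

(** The occurrences of [y] are moved to the front; each letter they pass is conjugated by a power of
    [y], which keeps it in [S]. *)
Let collect y l : S y -> {in l, forall x, S x} -> exists l' : seq G,
  [/\ {in l', forall x, S x}, size l = count_mem y l + size l' &
      mulseq l = y ^+ count_mem y l * mulseq l'].
Proof.
move=> Sy; elim: l => [|x l IHl] Sl; first by exists [::]; rewrite mul1g.
have Sx : S x by apply: Sl; exact: mem_head.
have [|l' [Sl' sz e]] := IHl; first by move=> z zl; apply: Sl; exact: mem_behead.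
have [->|/negPf neq] := eqVneq x y.
  by exists l'; rewrite mulseq_cons /= eqxx add1n sz expgS e mulgA.
exists (x ^ (y ^+ count_mem y l) :: l'); split.
- move=> z; rewrite inE => /predU1P[->|/Sl'//].
  by elim: (count_mem y l) => [|n IHn]; rewrite ?conjg1// expgSr conjgM; exact: conjS.
- by rewrite /= neq add0n sz addnS.
- by rewrite !mulseq_cons /= neq add0n e [LHS]mulgA (conjgC x) -mulgA.
Qed.

(** If [e.+1] is a common exponent of the elements of [S], a word with more than [size s * e]
    letters repeats some letter more than [e] times. Collecting that letter and deleting [e.+1]
    copies shortens the word, so words of bounded length give all products. *)
Lemma Dietzmann : exists H : set G, [/\ finite_set H, subgroup H & S `<=` H].
Proof.
have /finite_seqP[s sE] := finS.
have [e eP] : exists e, forall x, S x -> x ^+ e.+1 = 1.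
  have : forall x, x \in s -> torsion x by move=> x xs; apply: torS; rewrite sE.
  rewrite sE; elim: {sE} s => [|y s IHs] tors; first by exists 0.
  have [|e eP] := IHs; first by move=> x xs; apply: tors; exact: mem_behead.
  have [n yn] := tors y (mem_head _ _).
  exists (e.+1 * n.+1).-1 => x; rewrite prednK ?muln_gt0//= inE => /predU1P[->|/eP].
    by rewrite mulnC expgnA yn expg1n.
  by rewrite expgnA => ->; rewrite expg1n.
pose words := [set l : seq G | {in l, forall x, S x}].
have shorten l : words l -> size s * e < size l ->
    exists2 l', words l' & size l' < size l /\ mulseq l' = mulseq l.
  move=> Sl big; have [y ys ye] : exists2 y, y \in s & e < count_mem y l.
    apply: contrapT => noy; move: big; rewrite ltnNge => /negP; apply.
    have small y : y \in s -> count_mem y l <= e.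
      by move=> ys; rewrite leqNgt; apply/negP => ye; apply: noy; exists y.
    clear noy.
    have : {subset l <= s} by move=> x /Sl; rewrite sE.
    elim: {sE} s l small {Sl} => [|y s IHs] l small ls.
      by case: l ls {small} => [//|x l] /(_ _ (mem_head _ _)).
    rewrite /= mulSn -(count_predC (pred1 y) l) leq_add ?small ?mem_head//.
    rewrite -size_filter IHs// => [z zs|z].
      apply: leq_trans (small z _); last by rewrite in_cons zs orbT.
      by rewrite count_filter; apply: sub_count => x /andP[].
    by rewrite mem_filter => /andP[/= /negPf zy /ls]; rewrite inE zy.
  have Sy : S y by rewrite sE.
  have [l' [Sl' sz ml]] := collect Sy Sl.
  exists (nseq (count_mem y l - e.+1) y ++ l').
    by move=> x; rewrite mem_cat => /orP[/nseqP[->]|/Sl'].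
  rewrite size_cat size_nseq sz ltn_add2r; split.
    by rewrite ltn_subrL (leq_ltn_trans _ ye).
  rewrite mulseq_cat ml; congr (_ * _); rewrite -[in RHS](subnK ye) expgnDr eP// mulg1.
  by elim: (_ - _) => [//|n IHn]; rewrite expgS -IHn.
pose H := mulseq @` words.
have finH n : finite_set (mulseq @` [set l | words l /\ size l <= n]).
  elim: n => [|n IHn].
    apply: sub_finite_set (finite_set1 1) => _ [l [_ + ] <-].
    by rewrite leqn0 size_eq0 => /eqP ->.
  have finSn := finite_image2 *%g finS IHn.
  have : finite_set ([set (1 : G)] `|` [set x * y | x in S &
      y in mulseq @` [set l | words l /\ size l <= n]]).
    by rewrite finite_setU.
  apply: sub_finite_set => _ [[|x l] [Sl sz] <-]; first by left.
  right; exists x; first by apply: Sl; exact: mem_head.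
  by exists (mulseq l) => //; exists l => //; split=> // y yl; apply: Sl; exact: mem_behead.
exists H; split.
- apply: sub_finite_set (finH (size s * e)%N) => _ [l Sl <-].
  have [n] := ubnP (size l); elim: n l Sl => // n IHn l Sl ln.
  have [sle|/(shorten _ Sl)[l' Sl' [ll' <-]]] := leqP (size l) (size s * e).
    by exists l.
  by apply: IHn => //; exact: leq_trans ll' _.
- split=> [|_ _ [l Sl <-] [m Sm <-]|_ [l Sl <-]].
  + by exists [::].
  + exists (l ++ m); last exact: mulseq_cat.
    by move=> x; rewrite mem_cat => /orP[/Sl|/Sm].
  + elim: l Sl => [|x l IHl] Sl; first by exists [::] => //=; rewrite invg1.
    have [|m Sm em] := IHl; first by move=> y yl; apply: Sl; exact: mem_behead.
    have Sx : S x by apply: Sl; exact: mem_head.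
    (* The inverse of [x] is [x ^+ e], so inverses are again products of elements of [S]. *)
    exists (m ++ nseq e x).
      by move=> y; rewrite mem_cat => /orP[/Sm//|/nseqP[->]].
    rewrite mulseq_cat em /= invgM; congr (_ * _).
    apply/esym/mulg1_eq; rewrite -(eP _ Sx) expgS; congr (_ * _).
    by elim: (e) => [//|n IHn]; rewrite expgS -IHn.
- by move=> x Sx; exists [:: x]; [move=> y; rewrite inE => /eqP ->|exact: mulg1].
Qed.

End Dietzmann.

(** * Maps with few values on compact spaces *)

Section CompactSpaces.

(** Iterated splitting gives a binary tree of good sets. By compactness each branch has a common
    point, and [f] separates two branches at the first index where they differ. *)
Lemma cantor_scheme (T : topologicalType) (Y : Type) (f : T -> Y)
    (good : set (set T)) (A0 : set T) : compact [set: T] -> good A0 ->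
  (forall A, good A -> [/\ closed A, A !=set0 & exists B : bool -> set T,
    (forall b, good (B b) /\ B b `<=` A) /\
    forall x y, B true x -> B false y -> f x <> f y]) ->
  ([set: nat -> bool] #<= f @` A0)%card.
Proof.
move=> cT good0 goodP.
have /choice[c cP] (A : set T) : exists B : bool -> set T, good A ->
    (forall b, good (B b) /\ B b `<=` A) /\
    forall x y, B true x -> B false y -> f x <> f y.
  have [/goodP[_ _ [B BP]]|nA] := pselect (good A); first by exists B.
  (* A dummy value for sets that are not good; the tree below never meets them. *)
  by exists (fun=> A).
pose S (e : nat -> bool) := fix S n := if n is m.+1 then c (S m) (e m) else A0.
have goodS e n : good (S e n).
  by elim: n => [//|n IHn] /=; have [/(_ (e n))[]] := cP _ IHn.
have decS e m n : m <= n -> S e n `<=` S e m.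
  move=> /subnK <-; elim: (n - m) => [//|k IHk] x /=.
  by have [/(_ (e (k + m)))[_ sub] _] := cP _ (goodS e (k + m)) => /sub/IHk.
have /choice[p pP] (e : nat -> bool) : exists x, forall n, S e n x.
  pose F := filter_from setT (S e).
  have FF : ProperFilter F.
    apply: filter_from_proper => [|n _]; last by have [] := goodP _ (goodS e n).
    apply: filter_from_filter => [|m n _ _]; first by exists 0.
    exists (maxn m n) => // x Sx.
    by split; apply: decS Sx; rewrite ?leq_maxl ?leq_maxr.
  have [x [_ clx]] := cT F FF filterT; exists x => n.
  have [clS _ _] := goodP _ (goodS e n); apply: clS => N Nx.
  by apply: clx => //; exists n.
have fp_inj : injective (f \o p).
  move=> d e /= fpde; apply: contrapT => de.
  have exn : exists n, d n != e n.
    by apply: contrapT => /forallNP eqde; apply/de/funext => n; apply/eqP/negPn/negP.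
  have [n dn minn] := ex_minnP exn.
  have Sde : S d n = S e n.
    have : forall k, k <= n -> S d k = S e k.
      elim=> [//|k IHk] kn /=; rewrite IHk ?(ltnW kn)//; congr (c _ _).
      by apply/eqP/negPn/negP => /minn; rewrite leqNgt kn.
    exact.
  have [_ disj] := cP _ (goodS d n).
  move: (pP d n.+1) (pP e n.+1); rewrite /= -Sde.
  case: (d n) (e n) dn => -[]// _ pd pe.
    exact: (disj _ _ pd pe fpde).
  exact: (disj _ _ pe pd (esym fpde)).
have := inj_card_eq (A := setT) (in2W fp_inj).
rewrite card_eq_le => /andP[_ /card_le_trans]; apply; apply: subset_card_le.
by move=> _ [e _ <-]; exists (p e) => //; exact: (pP e 0).
Qed.

(** Otherwise the Cantor scheme applies to the closed subsets of [P] with nonempty interior relative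
    to [P]: such a set contains two points with distinct values, and disjoint neighbourhoods of
    these values pull back to two smaller such sets. *)
Lemma locally_constant_somewhere (T Y : topologicalType) (P : set T) (f : T -> Y) :
  compact [set: T] -> hausdorff_space T -> hausdorff_space Y ->
  continuous f -> closed P -> P !=set0 ->
  ~ ([set: nat -> bool] #<= f @` P)%card ->
  exists O, [/\ open O, O `&` P !=set0 &
    forall x y, (O `&` P) x -> (O `&` P) y -> f x = f y].
Proof.
move=> cT hT hY cf clP P0 small; apply: contrapT => noO; apply: small.
pose good A := [/\ closed A, A `<=` P &
  exists O, [/\ open O, O `&` P !=set0 & O `&` P `<=` A]].
apply: (@cantor_scheme _ _ f good P cT).
  by split=> //; exists setT; rewrite setTI; split=> //; exact: openT.
move=> A [clA AP [O [oO [z Oz] OA]]]; split=> //; first by exists z; exact: OA.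
have [x [y [Ox Oy fxy]]] : exists x y, [/\ (O `&` P) x, (O `&` P) y & f x <> f y].
  apply: contrapT => nxy; apply: noO; exists O; split=> // [|x y Ox Oy]; first by exists z.
  by apply: contrapT => fxy; apply: nxy; exists x, y.
(* Regularity of the compact Hausdorff space [T] supplies a closed neighbourhood of [u] inside the
   open set [O] and the preimage of [V]. *)
have small_good u V : (O `&` P) u -> nbhs (f u) V ->
    exists B, [/\ good B, B `<=` A & forall v, B v -> V (f v)].
  move=> [Ou Pu] Vu.
  have : nbhs u (O `&` f @^-1` V).
    by apply: filterI; [exact: open_nbhs_nbhs|exact: cf].
  move=> /(compact_regular hT cT (@filterT _ (nbhs u) _))[N Nu NV].
  exists (closure N `&` P); split=> [|v [/NV[Ov _] Pv]|v [/NV[]//]].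
    split=> //; first exact: closedI (@closed_closure _ _) clP.
    exists N^°; split; first exact: open_interior.
      by exists u.
    by move=> v [/interior_subset/subset_closure Nv Pv].
  exact: OA.
have /eqP nfxy := fxy.
move: hY; rewrite open_hausdorff => /(_ _ _ nfxy)[[U V] /= [/set_mem Ux /set_mem Vy]].
move=> [oU oV /eqP UV0].
have [B1 [gB1 B1A B1U]] := small_good x U Ox (open_nbhs_nbhs (conj oU Ux)).
have [B2 [gB2 B2A B2V]] := small_good y V Oy (open_nbhs_nbhs (conj oV Vy)).
exists (fun b => if b then B1 else B2); split=> [b|u v /= /B1U Uu /B2V Vv fuv].
  by case: b.
have : (U `&` V) (f u) by split=> //; rewrite fuv.
by rewrite UV0.
Qed.

(** If the image were infinite, the sets outside which [f] takes finitely many values on [P] would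
    form a proper filter; local finiteness excludes every cluster point of it in [P]. *)
Lemma compact_finite_image (T : topologicalType) (Y : Type) (P : set T) (f : T -> Y) :
  compact P ->
  (forall x, P x -> exists2 N, nbhs x N & finite_set (f @` (N `&` P))) ->
  finite_set (f @` P).
Proof.
move=> cP locfin; apply: contrapT => infP.
pose F := [set A : set T | finite_set (f @` (P `\` A))].
have FF : ProperFilter F.
  split; first by rewrite /F/= setD0.
  split=> [|A B FA FB|A B AB]; rewrite /F/=.
  - by rewrite setDT image_set0.
  - by rewrite setDIr image_setU finite_setU.
  - by apply: sub_finite_set; apply: image_subset => x [Px nBx]; split=> // /AB.
have FP : F P by rewrite /F/= setDv image_set0.
have [x [Px clx]] := cP F FF FP; have [N Nx finN] := locfin x Px.
have FN : F (~` N) by rewrite /F/= setDE setCK setIC.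
by have [y [nNy /nNy]] := clx _ _ FN Nx.
Qed.

End CompactSpaces.

(** * Topological groups and open centralizers *)

HB.mixin Record isTopGroup G of Topological G & Group G := {
  mulg_continuous : continuous (fun p : G * G => (p.1 * p.2)%g);
  invg_continuous : continuous (fun x : G => x^-1)%g
}.

#[short(type="topGroupType")]
HB.structure Definition TopGroup := {G of isTopGroup G & Topological G & Group G}.

HB.factory Record Topological_isTopGroup G of Topological G := {
  one : G;
  inv : G -> G;
  mul : G -> G -> G;
  mulgA : associative mul;
  mul1g : left_id one mul;
  mulg1 : right_id one mul;
  mulVg : left_inverse one inv mul;
  mulgV : right_inverse one inv mul;
  mulg_continuous : continuous (fun p : G * G => mul p.1 p.2);
  invg_continuous : continuous inv
}.

HB.builders Context G of Topological_isTopGroup G.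

HB.instance Definition _ := isGroup.Build G mulgA mul1g mulg1 mulVg mulgV.
HB.instance Definition _ := isTopGroup.Build G mulg_continuous invg_continuous.

HB.end.

Section TopologicalGroups.
Local Open Scope group_scope.
Variable G : topGroupType.
Implicit Types K : set G.

Lemma continuousM (T : topologicalType) (f g : T -> G) :
  continuous f -> continuous g -> continuous (fun x => f x * g x).
Proof.
move=> cf cg x.
apply: (@continuous_comp _ _ _ (fun x => (f x, g x)) (fun p : G * G => p.1 * p.2)).
  exact: cvg_pair (cf x) (cg x).
exact: mulg_continuous.
Qed.

Lemma continuousV (T : topologicalType) (f : T -> G) :
  continuous f -> continuous (fun x => (f x)^-1).
Proof. by move=> cf x; apply: continuous_comp; [exact: cf|exact: invg_continuous]. Qed.

Lemma continuous_mulgr (a : G) : continuous ( *%g^~ a).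
Proof.
by apply: (@continuousM G id (fun=> a)) => x; [exact: cvg_id|exact: cvg_cst].
Qed.

Lemma subgroup_closure K : subgroup K -> subgroup (closure K).
Proof.
move=> [K1 KM KV]; split=> [|x y clx cly|x clx].
- exact: subset_closure.
- move=> N /(@mulg_continuous G (x, y))[[U V] /= [Ux Vy] UVN].
  have [[x' [Kx' Ux']] [y' [Ky' Vy']]] := (clx _ Ux, cly _ Vy).
  by exists (x' * y'); split; [exact: KM|exact: (UVN (x', y'))].
- move=> N /(invg_continuous x)/clx[x' [Kx' Nx']].
  by exists x'^-1; split; [exact: KV|].
Qed.

(** This says that the centralizer is open, since a subgroup that is a neighbourhood of [1] is
    open. *)
Definition opencent (x : G) := nbhs 1 [set y | commute x y].

Lemma subgroup_opencent : subgroup opencent.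
Proof.
split=> [|x y cx cy|x cx]; rewrite /opencent.
- by apply: filterS filterT => y _; exact/commute_sym/commute1.
- apply: filterS (filterI cx cy) => z [xz yz].
  exact/commute_sym/commuteM/commute_sym.
- by apply: filterS cx => z /commute_sym xz; exact/commute_sym/commuteV.
Qed.

(** The conjugate [x ^ y] depends only on the coset of [y] modulo the centralizer, so it is locally
    constant in [y]. *)
Lemma opencent_fc (x : G) : compact [set: G] -> opencent x -> fc x.
Proof.
move=> cG cx; apply: compact_finite_image cG _ => g _.
exists [set y | commute x (y / g)].
  have /(_ g) := @continuous_mulgr g^-1.
  by apply; rewrite mulgV.
apply: sub_finite_set (finite_set1 (x ^ g)) => _ [y [xyg _] <-] /=.
rewrite -[in x ^ y](mulgVK g y) conjgM; congr (_ ^ g).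
exact/conjg_fixP/commgP.
Qed.

(** Conjugation of [x] is constant on some open set around a point [u]; translating by [u] to a
    neighbourhood of [1] gives elements that fix [x]. *)
Lemma small_class_opencent (x : G) : compact [set: G] -> hausdorff_space G ->
  ~ ([set: nat -> bool] #<= range (conjg x))%card -> opencent x.
Proof.
move=> cG hG small.
have cconj : continuous (conjg x).
  apply: (@continuousM G (fun y => y^-1) (fun y => x * y)).
    exact: invg_continuous.
  by apply: (@continuousM G (fun=> x) id) => y; [exact: cvg_cst|exact: cvg_id].
have [O [oO [u [Ou _]] Oconst]] :=
  locally_constant_somewhere cG hG hG cconj closedT (ex_intro _ 1 I) small.
rewrite /opencent; have : nbhs 1 [set z | O (z * u)].
  have /(_ 1) := @continuous_mulgr u.
  by apply; rewrite mul1g; exact: open_nbhs_nbhs.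
apply: filterS => z Ozu; apply/commgP/conjg_fixP.
by apply: (@conjg_inj _ u); rewrite -conjgM; exact: Oconst.
Qed.

End TopologicalGroups.

(** * Continuity and density in finite powers of the group *)

Section WordsOnProducts.
Local Open Scope group_scope.
Variables (G : topGroupType) (t : nat).
Local Notation Gt := {ptws 'I_t -> G}.

Lemma continuous_coord (i : 'I_t) : continuous (fun g : Gt => g i).
Proof. exact: (@proj_continuous 'I_t (fun=> G) i). Qed.

Lemma continuous_to_product (T : topologicalType) (h : T -> Gt) :
  (forall i, continuous (fun x => h x i)) -> continuous h.
Proof.
move=> ch x; apply/cvg_sup => i U [V [[W oW <-] Wx] VU].
by apply: filterS VU _; apply: (ch i x); exact: open_nbhs_nbhs.
Qed.

Lemma continuous_weval (w : seq (letter t)) : continuous (weval w : Gt -> G).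
Proof.
elim: w => [|[i b] w IHw]; first exact: (@cst_continuous Gt G 1).
apply: (@continuousM G Gt (fun g => if b then (g i)^-1 else g i)) => //.
by case: b; [apply: (@continuousV G Gt (fun g => g i))|]; exact: (@continuous_coord i).
Qed.

Lemma closure_box (D : set G) :
  [set g : Gt | forall i, closure D (g i)] `<=` closure [set g : Gt | forall i, D (g i)].
Proof.
pose Dt := [set g : Gt | forall i, D (g i)]; move=> g clg.
(* Coordinates are handled one at a time: only the first [n] are merely in the closure of [D], and
   the induction trades coordinate [n] for nearby points of [D]. *)
suff: forall n (h : Gt), (forall i : 'I_t, i < n -> closure D (h i)) ->
    (forall i : 'I_t, n <= i -> D (h i)) -> closure Dt h.
  by move=> /(_ t g); apply=> [i _|i]; [exact: clg|rewrite leqNgt ltn_ord].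
elim=> [|n IHn] h clh Dh; first by apply: subset_closure => i; exact: Dh.
have [tn|nt] := leqP t n.
  apply: IHn => i ni; first by apply: clh; exact: ltnW.
  by have := leq_trans (ltn_ord i) (leq_trans tn ni); rewrite ltnn.
pose j := Ordinal nt.
have hE : h = dfwith h j (h j) by apply/funext => i; case: dfwithP.
pose E := [set x | closure Dt (dfwith h j x)].
have clE : closed E.
  apply: (@closed_comp _ Gt (dfwith h j)); last exact: closed_closure.
  by move=> x _; exact: (@dfwith_continuous 'I_t (fun=> G) h j).
rewrite hE; apply: (clE); apply: closureS (clh j (ltnSn n)) => x Dx.
apply: IHn => i ni.
  rewrite dfwithout; first by apply: clh; exact: ltnW.
  by apply: contraTneq ni => <-; rewrite ltnn.
have [<-|ji] := eqVneq j i; first by rewrite dfwithin.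
by rewrite dfwithout//; apply: Dh; rewrite ltn_neqAle ni andbT.
Qed.

End WordsOnProducts.

(** * Profinite argument for words with few values *)

Section FewWordValues.
Local Open Scope group_scope.
Variables (G : topGroupType) (t : nat) (w : seq (letter t)).
Hypotheses (cG : compact [set: G]) (hG : hausdorff_space G).
Local Notation Gt := {ptws 'I_t -> G}.
Local Notation values := (word_values_in *%g (invg : G -> G) 1 w).
Local Notation generated := (closed_gen *%g (invg : G -> G) 1).

Lemma subgroup_generated (S : set G) : subgroup (generated S).
Proof.
split=> [H [H1 _ _]//|x y genx geny H sH clH SH|x genx H sH clH SH];
  have [_ HM HV] := sH.
- exact: HM (genx H sH clH SH) (geny H sH clH SH).
- exact: HV (genx H sH clH SH).
Qed.

Lemma closed_generated (S : set G) : closed (generated S).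
Proof.
move=> x clx H sH clH SH; apply: (clH) => N Nx.
have [y [geny Ny]] := clx N Nx; exists y; split=> //; exact: geny H sH clH SH.
Qed.

(** Cardinality below the continuum, expressed as the absence of an injection from the Cantor set
    [nat -> bool]. *)
Hypothesis few : ~ ([set: nat -> bool] #<= values setT)%card.

(** Conjugates of values are values, so the class of a value is small. *)
Lemma value_opencent : values setT `<=` @opencent G.
Proof.
move=> _ [g _ <-]; apply: small_class_opencent => //; apply: contra_not few.
move=> /card_le_trans; apply; apply: subset_card_le => _ [x _ <-].
by exists (fun i => g i ^ x) => //; exact: weval_conj.
Qed.

Let K := generated (values setT).
Let A := @opencent G `&` K.

Let sK : subgroup K. Proof. exact: subgroup_generated. Qed.

(** The closure of [A] is a closed subgroup that contains every value. *)
Let K_closureA : K `<=` closure A.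
Proof.
move=> x; apply; last 2 first.
- exact: closed_closure.
- move=> y Xy; apply: subset_closure; split; first exact: value_opencent.
  by move=> H _ _; apply.
apply: subgroup_closure.
have [[O1 OM OV] [K1 KM KV]] := (subgroup_opencent G, sK).
split=> [//|y z [Oy Ky] [Oz Kz]|y [Oy Ky]].
- by split; [exact: OM|exact: KM].
- by split; [exact: OV|exact: KV].
Qed.

Let Kt := [set g : Gt | forall i, K (g i)].
Let At := [set g : Gt | forall i, A (g i)].

Let Kt_closureAt : Kt `<=` closure At.
Proof. by move=> g Kg; apply: (@closure_box G t A) => i; exact: K_closureA (Kg i). Qed.

Let compactGt : compact [set: Gt].
Proof.
have := @tychonoff 'I_t (fun=> G) (fun=> setT) (fun=> cG).
by rewrite (_ : [set f | _] = setT)//; apply/seteqP.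
Qed.

Let closedKt : closed Kt.
Proof.
move=> g clg i; apply: closed_generated => N Ng.
have [h [Kh Nh]] := clg _ (@continuous_coord G t i g _ Ng).
by exists (h i); split=> //; exact: Kh.
Qed.

Lemma law_near_one :
  exists2 W : set Gt, nbhs ((fun=> 1) : Gt) W &
    forall c, W c -> Kt c -> weval w c = 1.
Proof.
have [|||||||O [oO [k0 [Ok0 Kk0]] constO]] :=
  @locally_constant_somewhere Gt G Kt (weval w).
- exact: compactGt.
- exact: (@hausdorff_product 'I_t (fun=> G)).
- exact: hG.
- exact: continuous_weval.
- exact: closedKt.
- by exists (fun=> 1) => i; have [] := sK.
- apply: contra_not few => /card_le_trans; apply; apply: subset_card_le.
  by move=> _ [g _ <-]; exists g.
have [a [Aa Oa]] := Kt_closureAt Kk0 (open_nbhs_nbhs (conj oO Ok0)).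
exists [set c : Gt | O (fun i => a i * c i) /\ forall i j, commute (a i) (c j)].
  apply: filterI.
    have : continuous (fun c : Gt => (fun i => a i * c i) : Gt).
      apply: continuous_to_product => i.
      apply: (@continuousM G Gt (fun=> a i)); last exact: continuous_coord.
      exact: (@cst_continuous Gt G).
    apply; apply: open_nbhs_nbhs; split=> //.
    by under eq_fun do rewrite mulg1.
  (* Only finitely many pairs of indices occur, so the open centralizers of the [a i] yield one
     neighbourhood of the identity tuple. *)
  apply: (@filter_forall Gt _ (fun i c => forall j, commute (a i) (c j)) _ (nbhs_filter _)) => i.
  apply: (@filter_forall Gt _ (fun j c => commute (a i) (c j)) _ (nbhs_filter _)) => j.
  by apply: (@continuous_coord G t j (fun=> 1)); have [] := Aa i.
move=> c [Oac comm] Kc; apply: (@mulgI _ (weval w a)).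
rewrite mulg1 -weval_mul_commute//.
have Ka i : K (a i) by have [] := Aa i.
by apply: constO; split=> // i; have [_ KM _] := sK; exact: KM.
Qed.

Lemma finite_values_in_verbal : finite_set (values K).
Proof.
have [W W1 lawW] := law_near_one.
apply: (@compact_finite_image Gt G Kt (weval w)).
  by apply: subclosed_compact compactGt _ => //; exact: closedKt.
move=> k Kk.
have W1' : nbhs ((fun=> 1) : Gt) W^° by exact: nbhs_interior.
(* Density of [At] in [Kt] puts [k] in a translate of the interior of [W] by some [s] in [At]. *)
have [s [As Wsk]] : At `&` [set s : Gt | W^° (fun i => (s i)^-1 * k i)] !=set0.
  apply: Kt_closureAt => //.
  have : continuous (fun s : Gt => (fun i => (s i)^-1 * k i) : Gt).
    apply: continuous_to_product => i.
    apply: (@continuousM G Gt (fun s => (s i)^-1) (fun=> k i)).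
      by apply: (@continuousV G Gt (fun g => g i)); exact: continuous_coord.
    exact: (@cst_continuous Gt G).
  have kVk : (fun i => (k i)^-1 * k i) = fun=> 1 by apply/funext => i; exact: mulVg.
  by apply; rewrite kVk.
have [|E [finE _ Es]] := @fc_weval_ratio G t w s.
  by move=> i; apply: opencent_fc => //; have [] := As i.
exists [set k' : Gt | W (fun i => (s i)^-1 * k' i)].
  have : continuous (fun k' : Gt => (fun i => (s i)^-1 * k' i) : Gt).
    apply: continuous_to_product => i.
    apply: (@continuousM G Gt (fun=> (s i)^-1)); last exact: continuous_coord.
    exact: (@cst_continuous Gt G).
  by apply.
(* Near [k] the tuple [c] obtained by dividing by [s] satisfies [weval w c = 1], so the value at
   [k'] equals its ratio to [weval w c] and lies in [E]. *)
apply: sub_finite_set finE => _ [k' [Wsk' Kk'] <-].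
pose c : Gt := fun i => (s i)^-1 * k' i.
have wc : weval w c = 1.
  apply: lawW => // i; have [_ KM KV] := sK.
  by apply: KM => //; apply: KV; have [] := As i.
have sc : (fun i => s i * c i) = k' by apply/funext => i; exact: mulVKg.
by have := Es c; rewrite wc divg1 sc.
Qed.

Let finite_closed (F : set G) : finite_set F -> closed F.
Proof. by have /accessible_finite_set_closed := hausdorff_accessible hG; apply. Qed.

(** The torsion criterion needs entries with finite conjugacy classes. Among the finitely many
    values on [K], [x] is isolated, so by density it is also attained at a tuple of [At]. *)
Lemma value_in_verbal_torsion x : values K x -> torsion x.
Proof.
move=> Kx; have [k Kk wk] := Kx.
have [a [Aa wa]] : At `&` [set g : Gt | (~` (values K `\ x)) (weval w g)] !=set0.
  apply: Kt_closureAt Kk _ _; apply: continuous_weval; apply: open_nbhs_nbhs.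
  split; last by rewrite -[weval w k]/(word_eval _ _ _ _ _) wk => -[_]; exact.
  apply: closed_openC.
  by apply: finite_closed; apply: finite_setD; exact: finite_values_in_verbal.
have Ka i : K (a i) by have [] := Aa i.
have -> : x = weval w a.
  apply: contrapT => xa; apply: wa; split; first by exists a.
  by move=> /= ax; exact: xa.
apply: (@weval_torsion G t w K) => // [|i]; first exact: finite_values_in_verbal.
by apply: opencent_fc => //; have [] := Aa i.
Qed.

Lemma finite_verbal_verbal :
  finite_set (verbal *%g (invg : G -> G) 1 w (verbal *%g (invg : G -> G) 1 w setT)).
Proof.
have [_ _ [g Kg <-] [h Kh <-]|H [finH sH KH]] :=
    Dietzmann finite_values_in_verbal value_in_verbal_torsion.
  exists (fun i => g i ^ weval w h); last exact: weval_conj.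
  have [_ KM KV] := sK; have Kwh : K (weval w h) by exact: weval_in.
  by move=> i; exact: KM (KV _ Kwh) (KM _ _ (Kg i) Kwh).
(* A finite subgroup is closed in a Hausdorff group, so it contains the closed subgroup generated by
   the values. *)
apply: sub_finite_set (finH) => x genx.
exact: (genx H sH (finite_closed finH) KH).
Qed.

End FewWordValues.

Theorem theorem1p1 (t : nat) (w : seq (letter t)) (G : topologicalType)
  (mul : G -> G -> G) (inv : G -> G) (one : G) :
  group_word w ->
  profinite_group mul inv one ->
  ~ ([set: nat -> bool] #<= word_values_in mul inv one w [set: G])%card ->
  finite_set (verbal mul inv one w (verbal mul inv one w [set: G])).
Proof.
case: G mul inv one => G cls mul inv one.
move=> _ [mulA mul1 mulV [cmul cinv] [cG hG _]].
(* The given operations become a topological group structure on the same carrier and topology. *)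
pose X : topologicalType := HB.pack G cls.
pose tG : topGroupType := HB.pack G X (Topological_isTopGroup.Build X mulA
  (fun x => (mul1 x).1) (fun x => (mul1 x).2) (fun x => (mulV x).1)
  (fun x => (mulV x).2) cmul cinv).
exact: (@finite_verbal_verbal tG).
Qed.
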